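(* Let $A$ be a finite-dimensional Hopf algebra over a field $k$ whose characteristic is not $2$. Assume that $H$ is a Hopf subalgebra of $A$, that there is a Hopf algebra projection of $A$ onto $H$, and that $A$ is a free right $H$-module of rank $2$ (under multiplication). Then one of the following holds: (a) $A \simeq B_{\alpha, y} \times H$ for some $\alpha \in \mathrm{G}(H^o)$ and $y \in \mathrm{G}(H)$ which satisfy $\alpha(y) = -1$ and $\alpha \rightharpoonup h \leftharpoonup \alpha^{-1} = yhy^{-1}$ for all $h \in H$; or (b) $A \simeq k[\mathbb{Z}_2] \otimes H$ as Hopf algebras over $k$. The latter, (b), is the case when $A$ is semisimple.
   Context: A Hopf algebra projection of $A$ onto $H$ means there are Hopf algebra maps $\pi : A \to H$ and $j : H \to A$ with $\pi \circ j = \mathrm{I}_H$. $\mathrm{G}(C)$ is the set of grouplike elements of a coalgebra $C$; $H^o$ is the finite dual, so $\mathrm{G}(H^o) = \mathrm{Alg}_k(H,k)$, and $\alpha^{-1}$ is the convolution inverse. $\alpha \rightharpoonup h = h_{(1)}\alpha(h_{(2)})$ and $h \leftharpoonup \alpha = \alpha(h_{(1)})h_{(2)}$. For $\alpha \in \mathrm{G}(H^o)$, $y \in \mathrm{G}(H)$, $B_{\alpha,y}$ is the $k$-algebra with basis $\{1,n\}$, $1$ the identity, $n^2 = 0$, with coalgebra structure $\Delta(1) = 1 \otimes 1$, $\Delta(n) = n \otimes 1 + 1 \otimes n$, left $H$-module structure $h\cdot 1 = \epsilon(h)1$, $h\cdot n = \alpha(h)n$, and left $H$-comodule structure $\rho(1)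 = 1 \otimes 1$, $\rho(n) = y \otimes n$. Under the stated conditions on $\alpha, y$ it is a Hopf algebra in the category ${}_H^H\mathcal{YD}$ of left-left Yetter–Drinfel'd modules over $H$. For a Hopf algebra $B$ of ${}_H^H\mathcal{YD}$, the biproduct $B \times H$ is the Hopf algebra over $k$ on the vector space $B \otimes H$ (tensors written $b \times h$) with the smash product and smash coproduct structures: $(b \times h)(b' \times h') = b(h_{(1)}\cdot b') \times h_{(2)}h'$, identity $1 \times 1$, $\Delta(b \times h) = (b_{(1)} \times b_{(2)(-1)}h_{(1)}) \otimes (b_{(2)(0)} \times h_{(2)})$, $\epsilon(b \times h) = \epsilon(b)\epsilon(h)$, where $\rho(b) = b_{(-1)} \otimes b_{(0)}$. *)

(* Defs.v *)
(* All vector spaces here are finite-dimensional: [vectType k] for spaces and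
   [falgType k] for associative unital algebras.                              *)
From HB Require Import structures.
From mathcomp Require Import all_boot all_order all_algebra all_fingroup all_field.

Set Implicit Arguments.
Unset Strict Implicit.
Unset Printing Implicit Defensive.

Import GRing.Theory.
Local Open Scope ring_scope.

Reserved Notation "a ⊗ b" (at level 40, left associativity).

(* The tensor product of V and W, in coordinates: the (i, j) entry of a tensor
   is its coefficient on e_i ⊗ e_j, for e the bases [vbasis fullv].           *)
Definition tens (k : fieldType) (V W : vectType k) : Type :=
  'M[k]_(\dim {:V}, \dim {:W}).

HB.instance Definition _ (k : fieldType) (V W : vectType k) :=
  Vector.copy (tens V W) 'M[k]_(\dim {:V}, \dim {:W}).

Section Tensor.
Variable k : fieldType.
Implicit Types V W U : vectType k.

Definition ptens V W (a : V) (b : W) : tens V W :=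
  \matrix_(i, j) (coord (vbasis {:V}) i a * coord (vbasis {:W}) j b).

Local Notation "a ⊗ b" := (ptens a b) : ring_scope.

(* The linear map V ⊗ W -> U induced by a bilinear f : V -> W -> U (see
   [tliftE]). In Sweedler notation, [tlift (fun x1 x2 => F x1 x2) (comul x)] is
   the sum F(x_(1), x_(2)).                                                   *)
Definition tlift V W U (f : V -> W -> U) (t : tens V W) : U :=
  \sum_i \sum_j t i j *: f (vbasis {:V})`_i (vbasis {:W})`_j.

Lemma tliftE V W U (f : V -> W -> U) (a : V) (b : W) :
    (forall w, linear (f^~ w)) -> (forall v, linear (f v)) ->
  tlift f (a ⊗ b) = f a b.
Proof.
move=> fl fr; pose Fl w := HB.pack_for {linear V -> U} (f^~ w)
  (GRing.isLinear.Build k V U _ (f^~ w) (fl w)).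
pose Fr v := HB.pack_for {linear W -> U} (f v)
  (GRing.isLinear.Build k W U _ (f v) (fr v)).
rewrite {2}(coord_vbasis (memvf a)) -[f _ b]/(Fl b _) linear_sum.
apply: eq_bigr => i _; rewrite linearZ /= -[f _ b]/(Fr _ b).
rewrite {2}(coord_vbasis (memvf b)) linear_sum scaler_sumr.
by apply: eq_bigr => j _; rewrite mxE linearZ scalerA.
Qed.

Lemma tlift_linear V W U (f : V -> W -> U) : linear (tlift f).
Proof.
move=> c t u; rewrite scaler_sumr -big_split; apply: eq_bigr => i _ /=.
rewrite scaler_sumr -big_split; apply: eq_bigr => j _ /=.
by rewrite !mxE scalerDl scalerA.
Qed.

Lemma ptens_linearl V W (b : W) : linear (fun a : V => a ⊗ b).
Proof. by move=> c a a'; apply/matrixP=> i j; rewrite !mxE linearP mulrDl mulrA. Qed.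

Lemma ptens_linearr V W (a : V) : linear (fun b : W => a ⊗ b).
Proof. by move=> c b b'; apply/matrixP=> i j; rewrite !mxE linearP mulrDr mulrCA. Qed.

Definition tmap V W V' W' (f : V -> V') (g : W -> W') : tens V W -> tens V' W' :=
  tlift (fun a b => f a ⊗ g b).

End Tensor.

Notation "a ⊗ b" := (ptens a b) : ring_scope.

Definition tmul (k : fieldType) (A B : falgType k) (t u : tens A B) : tens A B :=
  tlift (fun (a : A) (b : B) => tlift (fun (a' : A) (b' : B) => (a * a' : A) ⊗ (b * b' : B)) u) t.

HB.mixin Record Falgebra_isHopf (k : fieldType) A of Falgebra k A := {
  comul : {linear A -> tens A A};
  counit : {lrmorphism A -> k^o};
  antipode : {linear A -> A};
  comulA_subproof : forall x : A,
    tlift (fun a b : A => tlift (fun a1 a2 : A => a1 ⊗ (a2 ⊗ b)) (comul a)) (comul x)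
      = tlift (fun a b : A => a ⊗ comul b) (comul x);
  counitl_subproof : forall x : A, tlift (fun a b : A => (counit a : k) *: b) (comul x) = x;
  counitr_subproof : forall x : A, tlift (fun a b : A => (counit b : k) *: a) (comul x) = x;
  comul1_subproof : comul 1 = (1 : A) ⊗ (1 : A);
  comulM_subproof : forall x y : A, comul (x * y) = tmul (comul x) (comul y);
  antipodel_subproof : forall x : A,
    tlift (fun a b : A => antipode a * b : A) (comul x) = (counit x : k)%:A;
  antipoder_subproof : forall x : A,
    tlift (fun a b : A => a * antipode b : A) (comul x) = (counit x : k)%:A
}.

#[short(type="hopfAlgType")]
HB.structure Definition HopfAlgebra (k : fieldType) :=
  { A of Falgebra k A & Falgebra_isHopf k A }.

(* The Hopf algebra laws, at the canonical instances of H. *)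
Section HopfLaws.
Variables (k : fieldType) (H : hopfAlgType k).

Lemma comulA (x : H) :
  tlift (fun a b : H => tlift (fun a1 a2 : H => a1 ⊗ (a2 ⊗ b)) (comul a)) (comul x)
      = tlift (fun a b : H => a ⊗ comul b) (comul x).
Proof. exact: comulA_subproof. Qed.

Lemma counitl (x : H) :
  tlift (fun a b : H => (counit a : k) *: b) (comul x) = x.
Proof. exact: counitl_subproof. Qed.

Lemma counitr (x : H) :
  tlift (fun a b : H => (counit b : k) *: a) (comul x) = x.
Proof. exact: counitr_subproof. Qed.

Lemma comul1 : comul (1 : H) = (1 : H) ⊗ (1 : H).
Proof. exact: comul1_subproof. Qed.

Lemma comulM (x y : H) :
  comul (x * y) = tmul (comul x) (comul y).
Proof. exact: comulM_subproof. Qed.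

Lemma antipodel (x : H) :
  tlift (fun a b : H => antipode a * b : H) (comul x) = (counit x : k)%:A.
Proof. exact: antipodel_subproof. Qed.

Lemma antipoder (x : H) :
  tlift (fun a b : H => a * antipode b : H) (comul x) = (counit x : k)%:A.
Proof. exact: antipoder_subproof. Qed.

End HopfLaws.

Section Hopf.
Variable k : fieldType.
Implicit Types A H : hopfAlgType k.

(* A bialgebra map between Hopf algebras commutes with the antipodes. *)
Definition hopf_map H A (f : {lrmorphism H -> A}) : Prop :=
  (forall h, comul (f h) = tmap f f (comul h)) /\
  (forall h, counit (f h) = counit h).

Definition hopf_projection A H : Prop :=
  exists (pi : {lrmorphism A -> H}) (j : {lrmorphism H -> A}),
    [/\ hopf_map pi, hopf_map j & cancel j pi].

Definition free_right_module H A (i : {lrmorphism H -> A}) (n : nat) : Prop :=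
  exists e : 'I_n -> A, forall a : A,
    exists! h : {ffun 'I_n -> H}, a = \sum_(r < n) e r * i (h r).

(* A is semisimple as a left module over itself; the submodules are the left
   ideals, and these are k-subspaces because A is unital.                     *)
Definition semisimple_alg (A : falgType k) : Prop :=
  forall I : {vspace A}, (fullv * I <= I)%VS ->
    exists J : {vspace A},
      [/\ (fullv * J <= J)%VS, (I + J)%VS = fullv & (I :&: J)%VS = 0%VS].

Definition grouplike H (y : H) : Prop := comul y = y ⊗ y /\ counit y = 1.

(* The grouplike elements of the finite dual of H are the algebra maps
   {lrmorphism H -> k^o}.                                                     *)
Definition convolution_inverse H (f g : H -> k^o) : Prop :=
  forall h, tlift (fun a b : H => f a * g b : k^o) (comul h) = counit h /\
            tlift (fun a b : H => g a * f b : k^o) (comul h) = counit h.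

(* [lharp f h] is f ⇀ h, and [rharp h f] is h ↼ f. *)
Definition lharp H (f : H -> k) (h : H) : H :=
  tlift (fun h1 h2 : H => f h2 *: h1) (comul h).

Definition rharp H (h : H) (f : H -> k) : H :=
  tlift (fun h1 h2 : H => f h1 *: h2) (comul h).

End Hopf.

(* The operations of a bialgebra, without its laws. Concrete Hopf algebras are
   given in this form; as [bialg_iso] preserves all the operations, anything
   isomorphic to a Hopf algebra is one, with the transported antipode.        *)
Record bialgOps (k : fieldType) := BialgOps {
  bcarrier :> vectType k;
  bone : bcarrier;
  bmul : bcarrier -> bcarrier -> bcarrier;
  bcomul : bcarrier -> tens bcarrier bcarrier;
  bcounit : bcarrier -> k^o
}.

Definition bialg_iso (k : fieldType) (X Y : bialgOps k) : Prop :=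
  exists f : {linear X -> Y},
    [/\ bijective f,
        f (bone X) = bone Y,
        forall a b, f (bmul a b) = bmul (f a) (f b),
        forall a, bcomul (f a) = tmap f f (bcomul a)
      & forall a, bcounit (f a) = bcounit a].

Definition hopf_ops (k : fieldType) (H : hopfAlgType k) : bialgOps k :=
  @BialgOps k H 1 (fun a b => a * b) comul counit.

Definition tensor_ops (k : fieldType) (X Y : bialgOps k) : bialgOps k :=
  @BialgOps k (tens X Y) (bone X ⊗ bone Y)
    (fun t u => tlift (fun x y =>
       tlift (fun x' y' => bmul x x' ⊗ bmul y y') u) t)
    (tlift (fun x y =>
       tlift (fun x1 x2 => tlift (fun y1 y2 => (x1 ⊗ y1) ⊗ (x2 ⊗ y2))
                                 (bcomul y)) (bcomul x)))
    (tlift (fun x y => bcounit x * bcounit y : k^o)).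

Section GroupAlgebra.
Variables (k : fieldType) (gT : finGroupType).

Definition gdelta (g : gT) : {ffun gT -> k^o} := [ffun x => (x == g)%:R].

Definition group_algebra_ops : bialgOps k :=
  @BialgOps k {ffun gT -> k^o} (gdelta 1%g)
    (fun u v => \sum_g \sum_h (u g * v h) *: gdelta (g * h)%g)
    (fun u => \sum_g u g *: (gdelta g ⊗ gdelta g))
    (fun u => \sum_g u g).

End GroupAlgebra.

(* The operations of a bialgebra in the left-left Yetter-Drinfel'd modules over
   H: a bialgebra with an action h . b and a coaction b_(-1) ⊗ b_(0).          *)
Record ydOps (k : fieldType) (H : vectType k) := YDOps {
  yd_bialg :> bialgOps k;
  yd_act : H -> yd_bialg -> yd_bialg;
  yd_coact : yd_bialg -> tens H yd_bialg
}.

Section Biproduct.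
Variables (k : fieldType) (H : hopfAlgType k).

Definition biproduct_ops (B : ydOps H) : bialgOps k :=
  @BialgOps k (tens B H) (bone B ⊗ (1 : H))
    (fun t u => tlift (fun (b : B) (h : H) => tlift (fun (b' : B) (h' : H) =>
       tlift (fun h1 h2 : H => bmul b (yd_act h1 b') ⊗ (h2 * h' : H)) (comul h)) u) t)
    (tlift (fun (b : B) (h : H) =>
       tlift (fun b1 b2 : B =>
         tlift (fun (c : H) (b0 : B) =>
           tlift (fun h1 h2 : H => (b1 ⊗ (c * h1 : H)) ⊗ (b0 ⊗ h2)) (comul h))
         (yd_coact b2)) (bcomul b)))
    (tlift (fun (b : B) (h : H) => bcounit b * counit h : k^o)).

(* The pair (s, t) stands for s1 + tn. *)
Definition Balphay (alpha : {lrmorphism H -> k^o}) (y : H) : ydOps H :=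
  let V := (k^o * k^o)%type in
  let one : V := (1, 0) in
  let n : V := (0, 1) in
  @YDOps k H
    (@BialgOps k V one
       (fun a b => (a.1 * b.1, a.1 * b.2 + a.2 * b.1))
       (fun a => a.1 *: (one ⊗ one) + a.2 *: (n ⊗ one + one ⊗ n))
       (fun a => a.1))
    (fun h a => (counit h * a.1, alpha h * a.2))
    (fun a => a.1 *: ((1 : H) ⊗ one) + a.2 *: (y ⊗ n)).

End Biproduct.

(* Main.v *)
Require Import Defs.
From HB Require Import structures.
From mathcomp Require Import all_boot all_order all_algebra all_fingroup all_field.

(**
Write H0 for the image of the inclusion j of the projection (p, j) of A onto
H.  The map proj, a |-> a_(1) j(S(p(a_(2)))), sends A onto the space B of
coinvariants of p, and a = proj(a_(1)) j(p(a_(2))) ([proj_mul_j]), so a basis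
of B is a basis of A as a right H-module through j ([coinvariant_free]).  The
freeness hypothesis concerns the given inclusion i of H, which need not be j;
but it gives dim A = 2 dim H, and this alone forces dim B = 2.  So B is spanned
by 1 and an element n with counit 0, and proj(a) = counit(a) 1 + nu(a) n for a
linear form nu ([coinvariant_dim2]).

As n is coinvariant, Delta(n) lies in A ⊗ B, hence Delta(n) = n ⊗ 1 + u ⊗ n for
some u, and coassociativity makes u grouplike ([comul_n], [twist_grouplike]).
Put y = p(u) and c = nu(u).  Then u = (1 + c n) j(y) ([twistE]).  The elements
of H move past n by j(h) n = alpha(h_(1)) n j(h_(2)) for an algebra map alpha
([j_n], [act_charM]), and computing (p ⊗ nu) Delta(j(h) n) in two ways
yields the compatibility between alpha and y ([act_char_compat]).  Finally n^2
is a multiple of n.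

If c = 0, then u = j(y), and comparing the coefficients of n in the second
factors of the two sides of Delta(n)^2 = Delta(n^2) gives alpha(y) = -1 and
n^2 = 0, which is case (a) ([skew_primitive_case]).  In that case n A n = 0, so
A n is a nonzero left ideal of square zero and A is not semisimple
([nilpotent_ideal], [semisimple_semiprime]).

If c is not 0, the same kind of comparison, applied to u, gives u j(y) = u, so
that y = 1 and u = 1 + c n.  Then u^2 is grouplike and of the form 1 + d n;
this leaves only u^2 = 1 ([grouplike_case]).  As 2 is invertible, n^2 is then a
nonzero multiple of n, hence alpha is idempotent for convolution, alpha is the
counit, and u commutes with H0: this is case (b).

In both cases the isomorphism is the inverse of b ⊗ h |-> b j(h), and all that
has to be verified is that this map respects the operations on pure tensors
([bialg_iso_of_tens]).
*)

Set Implicit Arguments.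
Unset Strict Implicit.
Unset Printing Implicit Defensive.

Import GRing.Theory.
Local Open Scope ring_scope.

(** * Linear maps *)

Section Linear.
Variable k : fieldType.
Implicit Types (V W U X : vectType k) (R : falgType k).

Lemma lin_id V : linear (fun x : V => x).
Proof. by []. Qed.

Lemma lin_comp V W U (g : {linear W -> U}) (f : V -> W) :
  linear f -> linear (fun x => g (f x)).
Proof. by move=> lf c u v; rewrite lf linearP. Qed.

Lemma lin_fun1 V W U (g : W -> U) (f : V -> W) :
  linear g -> linear f -> linear (fun x => g (f x)).
Proof. by move=> lg lf c u v; rewrite lf lg. Qed.

Lemma lin_fun2l V W U T (g : W -> T -> U) (t : T) (f : V -> W) :
  (forall t, linear (fun w => g w t)) -> linear f -> linear (fun x => g (f x) t).
Proof. by move=> lg lf c u v; rewrite lf lg. Qed.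

Lemma lin_fun2r V W U T (g : T -> W -> U) (t : T) (f : V -> W) :
  (forall t, linear (fun w => g t w)) -> linear f -> linear (fun x => g t (f x)).
Proof. by move=> lg lf c u v; rewrite lf lg. Qed.

Lemma lin_mull V R (a : R) (f : V -> R) :
  linear f -> linear (fun x => f x * a).
Proof. by move=> lf c u v; rewrite lf mulrDl scalerAl. Qed.

Lemma lin_mulr V R (a : R) (f : V -> R) :
  linear f -> linear (fun x => a * f x).
Proof. by move=> lf c u v; rewrite lf mulrDr scalerAr. Qed.

Lemma lin_scalel V W (w : W) (f : V -> k^o) :
  linear f -> linear (fun x => (f x : k) *: w).
Proof. by move=> lf c u v; rewrite lf scalerDl scalerA. Qed.

Lemma lin_scaler V W (a : k) (f : V -> W) :
  linear f -> linear (fun x => a *: f x).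
Proof. by move=> lf c u v; rewrite lf scalerDr !scalerA mulrC. Qed.

Lemma lin_ptensl V W U (w : U) (f : V -> W) :
  linear f -> linear (fun x => f x ⊗ w).
Proof. by move=> lf c u v; rewrite lf ptens_linearl. Qed.

Lemma lin_ptensr V W U (w : U) (f : V -> W) :
  linear f -> linear (fun x => w ⊗ f x).
Proof. by move=> lf c u v; rewrite lf ptens_linearr. Qed.

Lemma lin_tlift V W U X (f : W -> U -> X) (t : V -> tens W U) :
  linear t -> linear (fun x => tlift f (t x)).
Proof. by move=> lf c u v; rewrite lf tlift_linear. Qed.

Lemma lin_tlift_body V W U X (f : V -> W -> U -> X) (t : tens W U) :
  (forall a b, linear (fun x => f x a b)) -> linear (fun x => tlift (f x) t).
Proof.
move=> lf c u v; rewrite /tlift scaler_sumr -big_split; apply: eq_bigr => i _ /=.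
rewrite scaler_sumr -big_split; apply: eq_bigr => j _ /=.
by rewrite lf scalerDr !scalerA mulrC.
Qed.

End Linear.

(** The universal property of the tensor product is available for functions
    that are linear in each variable, so that every step of a Sweedler
    computation leaves linearity obligations; [lin] discharges them by
    following the one occurrence of the variable down the expression. *)
Ltac lin := intros; cbv beta; first
 [ match goal with H : _ |- linear _ => first [solve [simple apply H]
     | apply: (lin_fun1 H); lin | apply: (lin_fun2l _ H); lin
     | apply: (lin_fun2r _ H); lin] end
 | lazymatch goal with
 | |- linear (fun x => x) => exact: lin_id
 | |- linear (fun x => @?a x * @?f x) => first [apply: lin_mulr; lin | apply: lin_mull; lin]
 | |- linear (fun x => @?a x *: @?f x) => first [apply: lin_scaler; lin | apply: lin_scalel; lin]
 | |- linear (fun x => @?a x ⊗ @?f x) => first [apply: lin_ptensr; lin | apply: lin_ptensl; lin]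
 | |- linear (fun x => tlift _ _) => first [apply: lin_tlift; lin | apply: lin_tlift_body; lin]
 | |- linear (tlift _) => exact: tlift_linear
 | |- linear (ptens _) => exact: ptens_linearr
 | |- linear ( *%R ?a) => exact: (lin_mulr a (@lin_id _ _))
 | |- linear ( *:%R ?a) => exact: (lin_scaler a (@lin_id _ _))
 | |- linear (fun x => _ (@?f x)) => apply: (@lin_comp _ _ _ _ _ f); lin
 | |- linear ?f => exact: linearP
 | _ => done
 end ].

(** [Δ[a, b <- x] E] is the Sweedler sum of E over a = x_(1), b = x_(2). *)
Notation "'Δ[' a , b <- x ] E" := (tlift (fun a b => E) (comul x))
  (at level 200, a name, b name, x at level 99, E at level 200).

(** Turns a function proved linear after the fact into a bundled linear map, so
    that the general theory of linear maps applies to it. *)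
Lemma linear_pack (k : fieldType) (V W : vectType k) (f : V -> W) : linear f ->
  exists F : {linear V -> W}, F =1 f.
Proof.
move=> lf; exists (HB.pack_for {linear V -> W} f (GRing.isLinear.Build k V W _ f lf)).
by [].
Qed.

Lemma surjective_dim_ker0 (k : fieldType) (V W : vectType k) (F : 'Hom(V, W)) :
  \dim {:V} = \dim {:W} -> (forall w, exists v, F v = w) -> lker F == 0%VS.
Proof.
move=> dVW surjF; have := limg_ker_dim F fullv; rewrite capfv.
have -> : limg F = fullv.
  apply/eqP; rewrite eqEsubv subvf; apply/subvP=> w _.
  by have [v <-] := surjF w; rewrite memv_img ?memvf.
by rewrite -dVW => /eqP; rewrite -[X in _ == X]add0n eqn_add2r dimv_eq0.
Qed.

(** * Linear maps out of a tensor product *)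

Section Tensor.
Variable k : fieldType.
Implicit Types (V W U X : vectType k).

Lemma eq_tlift V W U (f g : V -> W -> U) (t : tens V W) :
  (forall a b, f a b = g a b) -> tlift f t = tlift g t.
Proof. by move=> fg; apply: eq_bigr => i _; apply: eq_bigr => j _; rewrite fg. Qed.

Lemma linear_scale V W (f : V -> W) (lf : linear f) c v : f (c *: v) = c *: f v.
Proof.
pose F := HB.pack_for {linear V -> W} f (GRing.isLinear.Build k V W _ f lf).
by rewrite -[f]/(F : V -> W) linearZ.
Qed.

(** A linear map goes through a Sweedler sum whether or not the summand is
    bilinear, because [tlift] is a sum over pairs of basis vectors. *)
Lemma tlift_map V W U X (g : U -> X) (lg : linear g) (f : V -> W -> U) (t : tens V W) :
  g (tlift f t) = tlift (fun a b => g (f a b)) t.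
Proof.
pose G := HB.pack_for {linear U -> X} g (GRing.isLinear.Build k U X _ g lg).
rewrite -[g]/(G : U -> X) linear_sum; apply: eq_bigr => i _.
by rewrite linear_sum; apply: eq_bigr => j _; rewrite linearZ.
Qed.

Lemma tlift_add V W U (f g : V -> W -> U) (t : tens V W) :
  tlift (fun a b => f a b + g a b) t = tlift f t + tlift g t.
Proof.
rewrite /tlift -big_split; apply: eq_bigr => i _; rewrite -big_split.
by apply: eq_bigr => j _; rewrite scalerDr.
Qed.

Lemma tliftD V W U (f : V -> W -> U) (s t : tens V W) :
  tlift f (s + t) = tlift f s + tlift f t.
Proof. by rewrite -{1}[s]scale1r tlift_linear scale1r. Qed.

Lemma tlift_sum V W U n (F : 'I_n -> V -> W -> U) (t : tens V W) :
  tlift (fun a b => \sum_r F r a b) t = \sum_r tlift (F r) t.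
Proof.
rewrite /tlift [RHS]exchange_big; apply: eq_bigr => i _; rewrite [RHS]exchange_big.
by apply: eq_bigr => j _; rewrite scaler_sumr.
Qed.

Lemma tlift_id V W (t : tens V W) : tlift (fun a b => a ⊗ b) t = t.
Proof.
apply/matrixP=> i j; rewrite summxE (bigD1 i) //= summxE (bigD1 j) //=.
have cE (Z : vectType k) (i' j' : 'I_(\dim {:Z})) :
    coord (vbasis {:Z}) i' (vbasis {:Z})`_j' = (i' == j')%:R :> k.
  by rewrite coord_free ?(basis_free (vbasisP _)) // eq_sym.
rewrite !mxE !cE !eqxx !mulr1 big1 => [|j' /negPf nj]; last first.
  by rewrite !mxE !cE (eq_sym j) nj !mulr0.
rewrite big1 ?addr0 // => i' /negPf ni; rewrite summxE big1 // => j' _.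
by rewrite !mxE !cE (eq_sym i) ni mul0r mulr0.
Qed.

End Tensor.

(** * Sweedler calculus *)

Section Sweedler.
Variables (k : fieldType) (A : hopfAlgType k).
Implicit Types (V : vectType k) (x y : A).

(** Coassociativity is an equality in A ⊗ (A ⊗ A); both sides are compared by
    applying the linear map that f induces on this space. *)
Lemma sw_coassoc V (f : A -> A -> A -> V) x :
    (forall b c, linear (fun a => f a b c)) ->
    (forall a c, linear (fun b => f a b c)) ->
    (forall a b, linear (fun c => f a b c)) ->
  (Δ[a, c <- x] Δ[a, b <- a] f a b c) = (Δ[a, b <- x] Δ[b, c <- b] f a b c).
Proof.
move=> f1 f2 f3.
pose F := tlift (fun (a : A) (t : tens A A) => tlift (f a) t).
have FE a b c : F (a ⊗ (b ⊗ c)) = f a b c.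
  by rewrite /F tliftE ?tliftE //; lin.
have lF : linear F by rewrite /F; lin.
have := congr1 F (comulA x); rewrite !(tlift_map (g := F)) // => E.
transitivity (Δ[a, c <- x] F (Δ[a, b <- a] a ⊗ (b ⊗ c))).
  by apply: eq_tlift => a c; rewrite (tlift_map (g := F)) //; apply: eq_tlift.
rewrite {}E; apply: eq_tlift => a t.
rewrite -{1}[comul t]tlift_id (tlift_map (g := ptens a)); last by lin.
by rewrite (tlift_map (g := F)) //; apply: eq_tlift.
Qed.

Lemma sw_counitl V (f : A -> V) x : linear f ->
  (Δ[a, b <- x] (counit a : k) *: f b) = f x.
Proof.
move=> lf; rewrite -[in RHS](counitl x) (tlift_map lf).
by apply: eq_tlift => a b; rewrite (linear_scale lf).
Qed.

Lemma sw_counitr V (f : A -> V) x : linear f ->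
  (Δ[a, b <- x] (counit b : k) *: f a) = f x.
Proof.
move=> lf; rewrite -[in RHS](counitr x) (tlift_map lf).
by apply: eq_tlift => a b; rewrite (linear_scale lf).
Qed.

Lemma sw_antipodel V (f : A -> V) x : linear f ->
  (Δ[a, b <- x] f (antipode a * b)) = (counit x : k) *: f 1.
Proof.
by move=> lf; rewrite -(linear_scale lf) -(antipodel x) (tlift_map lf).
Qed.

Lemma sw_antipoder V (f : A -> V) x : linear f ->
  (Δ[a, b <- x] f (a * antipode b)) = (counit x : k) *: f 1.
Proof.
by move=> lf; rewrite -(linear_scale lf) -(antipoder x) (tlift_map lf).
Qed.

Lemma sw_1 V (f : A -> A -> V) :
    (forall b, linear (fun a => f a b)) -> (forall a, linear (fun b => f a b)) ->
  (Δ[a, b <- (1 : A)] f a b) = f 1 1.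
Proof. by move=> f1 f2; rewrite comul1 tliftE. Qed.

Lemma sw_mul V (f : A -> A -> V) x y :
    (forall b, linear (fun a => f a b)) -> (forall a, linear (fun b => f a b)) ->
  (Δ[a, b <- x * y] f a b) = (Δ[a, b <- x] Δ[c, d <- y] f (a * c) (b * d)).
Proof.
move=> f1 f2; rewrite comulM /tmul (tlift_map (g := tlift _)); last by lin.
apply: eq_tlift => a b; rewrite (tlift_map (g := tlift _)); last by lin.
by apply: eq_tlift => c d; rewrite tliftE.
Qed.

Lemma sw_hopf (B : hopfAlgType k) (p : {lrmorphism B -> A}) V (f : A -> A -> V) (x : B) :
    hopf_map p ->
    (forall b, linear (fun a => f a b)) -> (forall a, linear (fun b => f a b)) ->
  (Δ[a, b <- p x] f a b) = (Δ[a, b <- x] f (p a) (p b)).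
Proof.
move=> [pD _] f1 f2; rewrite pD /tmap (tlift_map (g := tlift _)); last by lin.
by apply: eq_tlift => a b; rewrite tliftE.
Qed.

End Sweedler.

(** * Grouplike elements *)

Section Grouplike.
Variables (k : fieldType) (H : hopfAlgType k).
Implicit Types y h : H.

Lemma sw_grouplike (V : vectType k) (f : H -> H -> V) y : grouplike y ->
    (forall b, linear (fun a => f a b)) -> (forall a, linear (fun b => f a b)) ->
  (Δ[a, b <- y] f a b) = f y y.
Proof. by move=> [-> _] f1 f2; rewrite tliftE. Qed.

Lemma grouplike_unit y : grouplike y -> y \is a GRing.unit.
Proof.
move=> gy; apply/unitrP; exists (antipode y); split.
  rewrite -(sw_grouplike (f := fun a b => antipode a * b) gy); try by lin.
  by rewrite antipodel gy.2 scale1r.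
rewrite -(sw_grouplike (f := fun a b => a * antipode b) gy); try by lin.
by rewrite antipoder gy.2 scale1r.
Qed.

Lemma grouplike_hopf (A : hopfAlgType k) (f : {lrmorphism H -> A}) y :
  hopf_map f -> grouplike y -> grouplike (f y).
Proof.
move=> hf gy; split; last by rewrite hf.2 gy.2.
by rewrite hf.1 /tmap sw_grouplike //; lin.
Qed.

Lemma grouplike1 : grouplike (1 : H).
Proof. by split; [exact: comul1 | exact: rmorph1]. Qed.

Lemma grouplikeM x y : grouplike x -> grouplike y -> grouplike (x * y).
Proof.
move=> gx gy; split; last by rewrite rmorphM /= gx.2 gy.2 mulr1.
rewrite -[LHS]tlift_id sw_mul; try by lin.
rewrite (sw_grouplike gx); try by lin.
by rewrite (sw_grouplike gy) //; lin.
Qed.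

End Grouplike.

(** * Harpoons and the convolution inverse of an algebra map *)

Section ConvolutionInverse.
Variables (k : fieldType) (H : hopfAlgType k) (alpha : {lrmorphism H -> k^o}).

Lemma convolution_inverse_antipode :
  convolution_inverse alpha (fun h => alpha (antipode h)).
Proof.
move=> h; split.
  transitivity (Δ[a, b <- h] alpha (a * antipode b)).
    by apply: eq_tlift => a b; rewrite rmorphM.
  by rewrite sw_antipoder ?rmorph1 ?[_ *: _]mulr1 //; lin.
transitivity (Δ[a, b <- h] alpha (antipode a * b)).
  by apply: eq_tlift => a b; rewrite rmorphM.
by rewrite sw_antipodel ?rmorph1 ?[_ *: _]mulr1 //; lin.
Qed.

(** The left and right harpoons commute, so (alpha ⇀ h) ↼ beta is
    alpha ⇀ (h ↼ beta); by compatibility, multiplying it on the right by y gives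
    y ((h ↼ beta) ↼ alpha), where beta and alpha cancel. *)
Lemma harpoon_conj (beta : {linear H -> k^o}) (y h : H) :
    convolution_inverse alpha beta -> y \is a GRing.unit ->
    (forall h, lharp alpha h * y = y * rharp h alpha) ->
  rharp (lharp alpha h) beta = y * h * y^-1.
Proof.
move=> ab uy compat; apply: (mulIr uy); rewrite mulrVK //.
have lR : linear (fun x => rharp x beta * y) by rewrite /rharp; lin.
transitivity (Δ[a, x <- h] (beta a : k) *: (lharp alpha x * y)).
  transitivity (Δ[x, c <- h] Δ[a, b <- x] (beta a : k) *: ((alpha c : k) *: (b * y))).
    rewrite {1}/lharp (tlift_map lR); apply: eq_tlift => x c.
    rewrite (linear_scale lR) /rharp.
    rewrite (tlift_map (g := fun b => (alpha c : k) *: (b * y))); last by lin.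
    by apply: eq_tlift => a b; rewrite -scalerAl !scalerA mulrC.
  rewrite sw_coassoc; try by lin.
  apply: eq_tlift => a x; rewrite /lharp.
  rewrite (tlift_map (g := fun b => (beta a : k) *: (b * y))); last by lin.
  by apply: eq_tlift => b c; rewrite -scalerAl.
transitivity (Δ[z, c <- h] Δ[a, b <- z] (beta a : k) *: ((alpha b : k) *: (y * c))).
  rewrite sw_coassoc; try by lin.
  apply: eq_tlift => a x; rewrite compat /rharp.
  rewrite (tlift_map (g := fun b => (beta a : k) *: (y * b))); last by lin.
  by apply: eq_tlift => b c; rewrite -scalerAr.
rewrite -[RHS](sw_counitl (f := fun x => y * x)); last by lin.
apply: eq_tlift => z c; have [_ <-] := ab z.
rewrite [RHS](tlift_map (g := fun a : k^o => (a : k) *: (y * c))); last by lin.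
by apply: eq_tlift => a b; rewrite scalerA.
Qed.

End ConvolutionInverse.

(** * Semisimple algebras are semiprime *)

(** If n A n = 0, the left ideal A n has square zero.  Write 1 = b n + f with f
    in a complementary left ideal J: then n = n b n + n f = n f lies in both
    A n and J. *)
Lemma semisimple_semiprime (k : fieldType) (A : falgType k) (n : A) :
  semisimple_alg A -> (forall a, n * a * n = 0) -> n = 0.
Proof.
move=> ssA nAn.
have [|R RE] := @linear_pack k A A (fun a => a * n); first by lin.
have IE a : reflect (exists b, a = b * n) (a \in limg (linfun R)).
  apply: (iffP memv_imgP) => [[b _ ->]|[b ->]]; exists b; rewrite ?memvf //;
  by rewrite lfunE /= RE.
have [|J [JP IJ IJ0]] := ssA (limg (linfun R)).
  apply/prodvP=> a b _ /IE[c ->]; apply/IE; exists (a * c).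
  by rewrite mulrA.
have /memv_addP[e /IE[a ->] [f fJ fE]] : 1 \in (limg (linfun R) + J)%VS.
  by rewrite IJ memvf.
have nf : n = n * f.
  by rewrite -[LHS]mulr1 fE mulrDr mulrA nAn add0r.
apply/eqP; rewrite -memv0 -IJ0 memv_cap; apply/andP; split.
  by apply/IE; exists 1; rewrite mul1r.
by rewrite nf; apply: (prodvP JP); rewrite ?memvf.
Qed.

(** * Hopf algebras with a projection *)

Section Projection.
Variables (k : fieldType) (A H : hopfAlgType k).
Variables (p : {lrmorphism A -> H}) (j : {lrmorphism H -> A}).
Hypotheses (p_hopf : hopf_map p) (j_hopf : hopf_map j) (jK : cancel j p).
Implicit Types (V : vectType k) (a b : A) (h : H).

(** Convolution of the identity with the inverse j S p of j p: the projection of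
    A onto its coinvariants. *)
Definition proj a : A := Δ[x, y <- a] x * j (antipode (p y)).

Definition coact a : tens A H := Δ[x, y <- a] x ⊗ p y.

Definition coinvariant b := coact b = b ⊗ (1 : H).

Lemma proj_linear : linear proj.
Proof. by rewrite /proj; lin. Qed.

(** Convolving back with j p, the factors j(S(p(a_(2)))) and j(p(a_(3)))
    cancel. *)
Lemma proj_mul_j a : (Δ[x, y <- a] proj x * j (p y)) = a.
Proof.
transitivity (Δ[x, z <- a] Δ[x, y <- x] x * (j (antipode (p y)) * j (p z))).
  apply: eq_tlift => x z; rewrite /proj (tlift_map (g := fun u => u * _)); last by lin.
  by apply: eq_tlift => *; rewrite mulrA.
rewrite sw_coassoc; try by lin.
rewrite -[RHS](sw_counitr (f := fun x => x)); last by lin.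
apply: eq_tlift => x y; transitivity (Δ[b, c <- p y] x * j (antipode b * c)).
  rewrite sw_hopf //; try by lin.
  by apply: eq_tlift => *; rewrite rmorphM.
rewrite (sw_antipodel (f := fun h => x * j h)); last by lin.
by rewrite rmorph1 mulr1 p_hopf.2.
Qed.

Lemma coinv_sw V (f : A -> H -> V) b : coinvariant b ->
    (forall h, linear (fun a => f a h)) -> (forall a, linear (fun h => f a h)) ->
  (Δ[x, y <- b] f x (p y)) = f b 1.
Proof.
move=> cb f1 f2; rewrite -(tliftE b 1) // -cb /coact (tlift_map (g := tlift f)); last by lin.
by apply: eq_tlift => x y; rewrite tliftE.
Qed.

(** The coaction (id ⊗ p) Delta is an algebra map, trivial on the coinvariant b
    and equal to (j ⊗ id) Delta on j(h). *)
Lemma coinv_mulr V (f : A -> H -> V) b h : coinvariant b ->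
    (forall h, linear (fun a => f a h)) -> (forall a, linear (fun h => f a h)) ->
  (Δ[x, y <- b * j h] f x (p y)) = (Δ[h1, h2 <- h] f (b * j h1) h2).
Proof.
move=> cb f1 f2; rewrite sw_mul; try by lin.
under eq_tlift do under eq_tlift do rewrite rmorphM.
rewrite (coinv_sw (f := fun x y => Δ[c, d <- j h] f (x * c) (y * p d))) //; try by lin.
rewrite sw_hopf //; try by lin.
by apply: eq_tlift => *; rewrite mul1r jK.
Qed.

Lemma coinv_mull V (f : A -> H -> V) b h : coinvariant b ->
    (forall h, linear (fun a => f a h)) -> (forall a, linear (fun h => f a h)) ->
  (Δ[x, y <- j h * b] f x (p y)) = (Δ[h1, h2 <- h] f (j h1 * b) h2).
Proof.
move=> cb f1 f2; rewrite sw_mul; try by lin.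
rewrite sw_hopf //; try by lin.
apply: eq_tlift => h1 h2.
under eq_tlift do rewrite rmorphM /= jK.
by rewrite (coinv_sw (f := fun x y => f (j h1 * x) (h2 * y))) ?mulr1 //; lin.
Qed.

Lemma proj_coinv_mulj b h : coinvariant b -> proj (b * j h) = (counit h : k) *: b.
Proof.
move=> cb; rewrite /proj (coinv_mulr (f := fun x y => x * j (antipode y))) //; try by lin.
transitivity (Δ[h1, h2 <- h] b * j (h1 * antipode h2)).
  by apply: eq_tlift => *; rewrite rmorphM mulrA.
rewrite (sw_antipoder (f := fun h => b * j h)); last by lin.
by rewrite rmorph1 mulr1.
Qed.

Lemma coinvariant1 : coinvariant 1.
Proof. by rewrite /coinvariant /coact sw_1 ?rmorph1 //; lin. Qed.

Lemma coinvariantM a b : coinvariant a -> coinvariant b -> coinvariant (a * b).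
Proof.
move=> ca cb; rewrite /coinvariant /coact sw_mul; try by lin.
under eq_tlift do under eq_tlift do rewrite rmorphM.
rewrite (coinv_sw (f := fun x y => Δ[c, d <- b] (x * c) ⊗ (y * p d))) //; try by lin.
rewrite (coinv_sw (f := fun x y => (a * x) ⊗ (1 * y))) ?mulr1 //; lin.
Qed.

(** The right action of H on A ⊗ H for which [coact] is H-linear, H acting on A
    through j; it serves to show that [proj] takes coinvariant values. *)
Definition ract (t : tens A H) h : tens A H :=
  tlift (fun (x : A) (g : H) => Δ[h1, h2 <- h] (x * j h1 : A) ⊗ (g * h2 : H)) t.

Lemma ract_linear h : linear (fun t => ract t h).
Proof. by rewrite /ract; lin. Qed.

Lemma ract_linearr t : linear (ract t).
Proof. by rewrite /ract; lin. Qed.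

Lemma ract_ptens a g h :
  ract (a ⊗ g) h = (Δ[h1, h2 <- h] (a * j h1 : A) ⊗ (g * h2 : H)).
Proof. by rewrite /ract tliftE //; lin. Qed.

Lemma ractM t h h' : ract (ract t h) h' = ract t (h * h').
Proof.
rewrite {2}/ract (tlift_map (ract_linear h')); apply: eq_tlift => x g.
rewrite (tlift_map (ract_linear h')) sw_mul; try by lin.
apply: eq_tlift => h1 h2; rewrite ract_ptens.
by apply: eq_tlift => h3 h4; rewrite rmorphM !mulrA.
Qed.

Lemma coact_mulj a h : coact (a * j h) = ract (coact a) h.
Proof.
rewrite /coact sw_mul; try by lin.
rewrite (tlift_map (ract_linear h)); apply: eq_tlift => x y.
rewrite ract_ptens sw_hopf //; try by lin.
by apply: eq_tlift => h1 h2; rewrite rmorphM /= jK.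
Qed.

(** The coaction applied to the decomposition of [proj_mul_j]: up to the action
    of H, it only sees [proj x ⊗ 1]. *)
Lemma coact_proj_mul a : coact a = (Δ[x, y <- a] ract (proj x ⊗ 1) (p y)).
Proof.
transitivity (Δ[x, y <- a] Δ[u, v <- x] (proj u * j (p v)) ⊗ p y).
  apply: eq_tlift => x y; rewrite -{1}(proj_mul_j x).
  by rewrite (tlift_map (g := fun x => x ⊗ p y)) //; lin.
have lp := proj_linear; rewrite sw_coassoc; try by lin.
apply: eq_tlift => x y; rewrite ract_ptens sw_hopf //; try by lin.
by apply: eq_tlift => h1 h2; rewrite mul1r.
Qed.

(** By [coact_mulj] and [coact_proj_mul], the coaction of proj(a) is
    proj(a_(1)) ⊗ 1 acted upon by p(a_(2)) and then by S(p(a_(3))), whose product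
    is a counit. *)
Lemma proj_coinv a : coinvariant (proj a).
Proof.
have lp := proj_linear; have lr := ract_linear; have lr' := ract_linearr.
have lc : linear coact by rewrite /coact; lin.
rewrite /coinvariant {1}/proj (tlift_map lc).
transitivity (Δ[x, y <- a] Δ[u, v <- x]
    ract (proj u ⊗ 1) (p v * antipode (p y))).
  apply: eq_tlift => x y; rewrite coact_mulj coact_proj_mul.
  rewrite (tlift_map (lr _)); apply: eq_tlift => u v; exact: ractM.
rewrite sw_coassoc; try by lin.
transitivity (Δ[x, y <- a] (counit y : k) *: (proj x ⊗ (1 : H))).
  apply: eq_tlift => x y.
  rewrite -(sw_hopf (f := fun u v => ract (proj x ⊗ 1) (u * antipode v)) y p_hopf); try by lin.
  rewrite (sw_antipoder (f := ract (proj x ⊗ 1))); last by lin.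
  rewrite p_hopf.2 ract_ptens sw_1; try by lin.
  by rewrite rmorph1 !mulr1.
by rewrite (sw_counitr (f := fun x => proj x ⊗ 1)) //; lin.
Qed.

Lemma proj_mulj a h : proj (a * j h) = (counit h : k) *: proj a.
Proof.
have lp := proj_linear.
rewrite -{1}(proj_mul_j a) (tlift_map (g := fun a => proj (a * j h))); last by lin.
rewrite -[in RHS](sw_counitr (f := proj) a) // (tlift_map (g := fun b : A => _ *: b)); last by lin.
apply: eq_tlift => x y; rewrite -mulrA -rmorphM proj_coinv_mulj; last exact: proj_coinv.
by rewrite rmorphM /= p_hopf.2 scalerA mulrC.
Qed.

Lemma mulj_coinv b h : coinvariant b ->
  j h * b = (Δ[h1, h2 <- h] proj (j h1 * b) * j h2).
Proof.
have lp := proj_linear => cb; rewrite -{1}(proj_mul_j (j h * b)).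
by rewrite (coinv_mull (f := fun x y => proj x * j y)) //; lin.
Qed.

Lemma counit_proj a : counit (proj a) = counit a.
Proof.
have lp := proj_linear.
rewrite -(sw_counitr (f := fun x => counit (proj x)) a); last by lin.
rewrite -[in RHS](proj_mul_j a) (tlift_map (g := counit)); last by lin.
by apply: eq_tlift => x y; rewrite rmorphM /= j_hopf.2 p_hopf.2 mulrC.
Qed.

Lemma coinv_p b : coinvariant b -> p b = (counit b : k)%:A.
Proof.
move=> cb; rewrite -(coinv_sw (f := fun x y => (counit x : k) *: y) cb); try by lin.
by rewrite sw_counitl //; lin.
Qed.

Lemma proj_coinvariant b : coinvariant b -> proj b = b.
Proof.
by move=> cb; rewrite -[b in proj b]mulr1 -(rmorph1 j) proj_coinv_mulj // rmorph1 scale1r.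
Qed.

End Projection.

(** * The coinvariants have dimension two *)

(** The dimension does not remember which embedding of H is used: this is how
    freeness through i constrains the coinvariants of a projection split by
    another embedding j. *)
Lemma free_right_module_dim (k : fieldType) (A H : hopfAlgType k)
    (i : {lrmorphism H -> A}) n :
  free_right_module i n -> \dim {:A} = (n * \dim {:H})%N.
Proof.
case=> e eP.
have [|F FE] := @linear_pack k _ _ (fun h : {ffun 'I_n -> H} => \sum_(r < n) e r * i (h r)).
  move=> c u v; rewrite scaler_sumr -big_split; apply: eq_bigr => r _ /=.
  by rewrite !ffunE linearP mulrDr scalerAr.
have injF : lker (linfun F) == 0%VS.
  apply/lker0P => u v; rewrite !lfunE /= !FE => Fuv.
  by have [w [_ uw]] := eP (\sum_(r < n) e r * i (u r)); rewrite -(uw u) // (uw v).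
have -> : fullv = limg (linfun F) :> {vspace A}.
  apply/eqP; rewrite eqEsubv subvf andbT; apply/subvP=> a _.
  have [w [-> _]] := eP a; rewrite -[\sum_r _]FE -(lfunE F); exact: memv_img (memvf w).
rewrite limg_dim_eq ?(eqP injF) ?capv0 // !dimvf.
by rewrite -[LHS]/(#|'I_n| * dim H)%N card_ord.
Qed.

Section Dimension.
Variables (k : fieldType) (A H : hopfAlgType k).
Variables (p : {lrmorphism A -> H}) (j : {lrmorphism H -> A}).
Hypotheses (p_hopf : hopf_map p) (j_hopf : hopf_map j) (jK : cancel j p).
Implicit Types (V : vectType k) (a b : A) (h : H).

Lemma coinvariant_vspace :
  exists B : {vspace A}, forall b, b \in B <-> coinvariant p b.
Proof.
have [|F FE] := @linear_pack k _ _ (fun b : A => coact p b - b ⊗ (1 : H)).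
  have lc : linear (coact p) by rewrite /coact; lin.
  by move=> c u v; rewrite lc ptens_linearl scalerBr opprD addrACA.
exists (lker (linfun F)) => b; rewrite memv_ker lfunE /= FE subr_eq0.
by split=> [/eqP//|cb]; apply/eqP.
Qed.

(** The map (xi proj ⊗ p) Delta reads off coefficients with respect to a family
    of coinvariants; this gives the uniqueness of such coefficients. *)
Lemma coef_sum n (b : 'I_n -> A) (h : 'I_n -> H) (xi : {linear A -> k^o}) :
    (forall r, coinvariant p (b r)) ->
  (Δ[x, y <- \sum_r b r * j (h r)] (xi (proj p j x) : k) *: p y)
   = \sum_r (xi (b r) : k) *: h r.
Proof.
move=> cb; have lp := proj_linear p j; rewrite linear_sum.
have lt : linear (tlift (fun x y : A => (xi (proj p j x) : k) *: p y)) by exact: tlift_linear.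
have [T TE] := linear_pack lt; rewrite -TE linear_sum; apply: eq_bigr => r _; rewrite TE.
rewrite (coinv_mulr (j := j) _ _ (f := fun x y => (xi (proj p j x) : k) *: y)) //; try by lin.
rewrite -[in RHS](sw_counitl (f := fun x => x) (h r)); last by lin.
rewrite (tlift_map (g := fun y : H => _ *: y)); last by lin.
apply: eq_tlift => x y; rewrite proj_coinv_mulj // linearZ /= scalerA.
by rewrite [X in _ = X *: _]mulrC.
Qed.

(** Expanding proj(a_(1)) in a basis of B in the formula
    a = proj(a_(1)) j(p(a_(2))) shows that this basis generates A. *)
Lemma coinvariant_free (B : {vspace A}) : (forall b, b \in B <-> coinvariant p b) ->
  free_right_module j (\dim B).
Proof.
move=> BP; pose e (r : 'I_(\dim B)) := (vbasis B)`_r; exists e => a.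
have ce r : coinvariant p (e r).
  by apply/BP/vbasis_mem/mem_nth; rewrite size_tuple.
have lp := proj_linear p j.
pose T (r : 'I_(\dim B)) a : H := Δ[x, y <- a] (coord (vbasis B) r (proj p j x) : k) *: p y.
exists [ffun r => T r a]; split=> [|h ->].
  under eq_bigr do rewrite ffunE.
  rewrite -{1}(proj_mul_j j p_hopf a).
  transitivity (Δ[x, y <- a] \sum_r e r * j ((coord (vbasis B) r (proj p j x) : k) *: p y)).
    apply: eq_tlift => x y.
    have /BP/coord_vbasis{1}-> := proj_coinv p_hopf j_hopf jK x.
    by rewrite mulr_suml; apply: eq_bigr => r _; rewrite linearZ /= -scalerAl -scalerAr.
  rewrite tlift_sum; apply: eq_bigr => r _.
  by rewrite (tlift_map (g := fun u => e r * j u)) //; lin.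
apply/ffunP=> r; rewrite ffunE /T coef_sum //.
rewrite (bigD1 r) //= big1 => [|s /negPf nsr].
  by rewrite coord_free ?(basis_free (vbasisP _)) // eqxx scale1r addr0.
by rewrite coord_free ?(basis_free (vbasisP _)) // nsr scale0r.
Qed.

(** The dimension of B is 2 by comparing the two expressions of dim A.  As the
    counit does not vanish at 1, its kernel in B is a line, spanned by n, and
    nu(a) is the coordinate on n of proj(a) - counit(a) 1. *)
Lemma coinvariant_dim2 : \dim {:A} = (2 * \dim {:H})%N ->
  exists (n : A) (nu : {linear A -> k^o}),
    [/\ coinvariant p n, counit n = 0, nu n = 1, nu 1 = 0
      & forall a, proj p j a = (counit a : k)%:A + (nu a : k) *: n].
Proof.
move=> dimA; have [B BP] := coinvariant_vspace.
have dimB : \dim B = 2%N.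
  have := free_right_module_dim (coinvariant_free BP); rewrite dimA => /eqP.
  rewrite eqn_pmul2r ?lt0n ?dimv_eq0; first by move/eqP.
  by apply/eqP=> H0; have := memvf (1 : H); rewrite H0 memv0 oner_eq0.
have B1 : 1 \in B by apply/BP/coinvariant1.
pose N := (B :&: lker (linfun (counit : A -> k^o)))%VS.
have dimN : \dim N = 1%N.
  have := limg_ker_dim (linfun (counit : A -> k^o)) B; rewrite dimB.
  suff -> : \dim (linfun (counit : A -> k^o) @: B) = 1%N by rewrite addn1 => -[].
  apply/eqP; rewrite eqn_leq; apply/andP; split.
    by apply: leq_trans (dimvS (subvf _)) _; rewrite dimvf.
  rewrite lt0n dimv_eq0; apply/eqP=> im0.
  have := memv_img (linfun (counit : A -> k^o)) B1.
  by rewrite im0 memv0 lfunE /= rmorph1 oner_eq0.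
pose n := vpick N.
have n0 : n != 0 by rewrite vpick0 -dimv_eq0 dimN.
have Nn : N = <[n]>%VS.
  apply/esym/eqP; rewrite eqEdim dim_vline n0 dimN leqnn andbT.
  by rewrite -memvE memv_pick.
have /memv_capP[/BP cn] : n \in N by rewrite memv_pick.
rewrite memv_ker lfunE /= => /eqP en.
have lp := proj_linear p j.
have [|nu nuE] := @linear_pack k A k^o
  (fun a => coord [tuple n] 0 (proj p j a - (counit a : k)%:A)).
  move=> c u v; rewrite lp linearP scalerDl opprD addrACA -scalerA -scalerBr.
  by rewrite linearP.
have projE a : proj p j a = (counit a : k)%:A + (nu a : k) *: n.
  have : proj p j a - (counit a : k)%:A \in N.
    rewrite memv_cap memvB ?memvZ //=; last exact/BP/proj_coinv.
    by rewrite memv_ker lfunE /= raddfB /= linearZ /= rmorph1 counit_proj // [_ *: _]mulr1 subrr.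
  rewrite Nn -span_seq1 => /(@coord_span _ _ _ [tuple n]).
  by rewrite big_ord1 nuE => <-; rewrite addrC subrK.
exists n, nu; split=> //.
  have := projE n; rewrite proj_coinvariant // en scale0r add0r => nE.
  have /eqP : ((nu n : k) - 1) *: n = 0 by rewrite scalerBl scale1r -nE subrr.
  by rewrite scaler_eq0 (negPf n0) orbF subr_eq0 => /eqP.
have := projE 1; rewrite proj_coinvariant ?rmorph1 ?scale1r //; last exact: coinvariant1.
rewrite -{1}[1]addr0 => /addrI/esym/eqP.
by rewrite scaler_eq0 (negPf n0) orbF => /eqP.
Qed.

End Dimension.

(** * Bialgebra isomorphisms onto tensor products *)

(** The operations of a biproduct or a tensor product are determined by their
    values on pairs of a vector of V and a vector of W, so that the map induced
    by f only has to be tested on those.  It is bijective because it is onto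
    between spaces of the same dimension, and its inverse is the isomorphism. *)
Lemma bialg_iso_of_tens (k : fieldType) (A : hopfAlgType k) (V W : vectType k)
    (one : tens V W) (m : V -> W -> V -> W -> tens V W)
    (D : V -> W -> tens (tens V W) (tens V W)) (e : V -> W -> k^o) (f : V -> W -> A) :
    (forall w, linear (fun v => f v w)) -> (forall v, linear (fun w => f v w)) ->
    \dim {:A} = (\dim {:V} * \dim {:W})%N ->
    (forall a, exists t, tlift f t = a) ->
    tlift f one = 1 ->
    (forall b h b' h', tlift f (m b h b' h') = f b h * f b' h') ->
    (forall b h, comul (f b h) = tmap (tlift f) (tlift f) (D b h)) ->
    (forall b h, counit (f b h) = e b h) ->
  bialg_iso (hopf_ops A)
    (@BialgOps k (tens V W) one
      (fun t u => tlift (fun b h => tlift (fun b' h' => m b h b' h') u) t)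
      (tlift D) (tlift e)).
Proof.
move=> f1 f2 dimA surjf f_one f_mul f_comul f_counit.
have [F FE] := linear_pack (tlift_linear f).
have FM t u : F (tlift (fun b h => tlift (fun b' h' => m b h b' h') u) t) = F t * F u.
  rewrite !FE [in RHS](tlift_map (g := fun a => a * _)); last by lin.
  rewrite (tlift_map (g := tlift f)); last by lin.
  apply: eq_tlift => b h; rewrite (tlift_map (g := tlift f)); last by lin.
  rewrite (tlift_map (g := fun a => f b h * a)); last by lin.
  by apply: eq_tlift => b' h'.
have FD t : comul (F t) = tmap F F (tlift D t).
  rewrite FE (tlift_map (g := comul)); last by lin.
  rewrite /tmap (tlift_map (g := tlift _)); last by lin.
  apply: eq_tlift => b h; rewrite f_comul.
  by apply: eq_tlift => x z; rewrite !FE.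
have kerF : lker (linfun F) == 0%VS.
  apply: surjective_dim_ker0 => [|a].
    by rewrite dimA; apply: etrans (dimvf _) _; exact: (dim_matrix k).
  by have [t <-] := surjf a; exists t; rewrite lfunE /= FE.
have limF : limg (linfun F) = fullv.
  apply/eqP; rewrite eqEsubv subvf; apply/subvP=> a _; have [t <-] := surjf a.
  by rewrite -FE -(lfunE F) memv_img ?memvf.
pose G := (linfun F)^-1%VF.
have FK t : G (F t) = t by rewrite -(lfunE F) lker0_lfunK.
have GK a : F (G a) = a.
  by rewrite -[F _](lfunE F) limg_lfunVK // limF memvf.
have F_inj := can_inj FK.
exists G; split.
- by exists F.
- by apply: F_inj; rewrite GK FE /= f_one.
- by move=> a b; apply: F_inj; rewrite /= FM !GK.
- move=> a /=; rewrite -{2}[a]GK FD /tmap (tlift_map (g := tlift _)); last by lin.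
  rewrite -[LHS]tlift_id; apply: eq_tlift => s t; rewrite tliftE ?FK //; lin.
- move=> a /=; rewrite -{2}[a]GK FE (tlift_map (g := counit)); last by lin.
  by apply: eq_tlift => b h; rewrite f_counit.
Qed.

Section Isos.
Variables (k : fieldType) (A H : hopfAlgType k) (j : {lrmorphism H -> A}).
Hypothesis j_hopf : hopf_map j.

(** Grouplike elements gr(x), multiplying as the elements of a finite group and
    commuting with H, that form a basis of A over H make A a tensor product. *)
Lemma group_algebra_tensor_iso (gT : finGroupType) (gr : gT -> A) :
    gr 1%g = 1 -> {morph gr : x z / (x * z)%g >-> x * z} ->
    (forall x, grouplike (gr x)) -> (forall x h, j h * gr x = gr x * j h) ->
    \dim {:A} = (#|gT| * \dim {:H})%N ->
    (forall a, exists h : gT -> H, a = \sum_x gr x * j (h x)) ->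
  bialg_iso (hopf_ops A) (tensor_ops (group_algebra_ops k gT) (hopf_ops H)).
Proof.
move=> gr1 grM gr_grouplike gr_comm dimA gr_span.
have [|phi phiE] := @linear_pack k {ffun gT -> k^o} A (fun u => \sum_x (u x : k) *: gr x).
  move=> c u v; rewrite scaler_sumr -big_split; apply: eq_bigr => x _ /=.
  by rewrite !ffunE scalerDl scalerA.
have phi_delta x : phi (gdelta k x) = gr x.
  rewrite phiE (bigD1 x) //= ffunE eqxx scale1r big1 ?addr0 // => z /negPf nz.
  by rewrite ffunE nz scale0r.
pose f u h := phi u * j h.
have f1 h : linear (fun u => f u h) by rewrite /f; lin.
have f2 u : linear (fun h => f u h) by rewrite /f; lin.
apply: (bialg_iso_of_tens (f := f)) => //=.
- by rewrite dimA [in RHS]dimvf -[dim {ffun _ -> _}]/(#|gT| * 1)%N muln1.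
- move=> a; have [h ->] := gr_span a; exists (\sum_x gdelta k x ⊗ h x).
  have [T TE] := linear_pack (tlift_linear f); rewrite -TE linear_sum.
  by apply: eq_bigr => x _; rewrite TE tliftE // /f phi_delta.
- by rewrite tliftE // /f phi_delta gr1 rmorph1 mulr1.
- move=> u h u' h'; rewrite tliftE // /f rmorphM !mulrA; congr (_ * _).
  have -> : phi u * j h * phi u' = phi u * phi u' * j h.
    rewrite -!mulrA; congr (_ * _); rewrite !phiE mulr_sumr mulr_suml.
    by apply: eq_bigr => x _; rewrite -scalerAl -scalerAr gr_comm.
  congr (_ * _); rewrite linear_sum !phiE mulr_suml; apply: eq_bigr => x _.
  rewrite linear_sum mulr_sumr; apply: eq_bigr => z _.
  by rewrite linearZ /= phi_delta grM -scalerAl -scalerAr scalerA.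
- move=> u h; have fE v z : tlift f (v ⊗ z) = f v z by rewrite tliftE.
  rewrite /tmap (tlift_map (g := tlift _)); last by lin.
  pose K u1 u2 := Δ[c, d <- h] f u1 c ⊗ f u2 d.
  rewrite (eq_tlift (g := K)) => [|u1 u2]; last first.
    rewrite (tlift_map (g := tlift _)); last by lin.
    by apply: eq_tlift => c d; rewrite tliftE ?fE //; lin.
  have [T TE] := linear_pack (tlift_linear K).
  rewrite {1}/f phiE mulr_suml -TE !linear_sum; apply: eq_bigr => x _.
  rewrite -scalerAl !linearZ /= TE tliftE; try by rewrite /K; lin.
  congr (_ *: _); rewrite -[LHS]tlift_id sw_mul; try by lin.
  rewrite (sw_grouplike (gr_grouplike x)); try by lin.
  rewrite sw_hopf; try by lin.
  by apply: eq_tlift => c d; rewrite /f phi_delta.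
- move=> u h; rewrite /f rmorphM /= j_hopf.2; congr (_ * _).
  rewrite phiE linear_sum; apply: eq_bigr => x _.
  by rewrite linearZ /= (gr_grouplike x).2 [_ *: _]mulr1.
Qed.

(** A biproduct with [Balphay alpha y] is recognized by a skew-primitive n of
    square zero past which H moves through alpha. *)
Lemma biproduct_iso (alpha : {lrmorphism H -> k^o}) (y : H) (n : A) :
    n * n = 0 -> comul n = n ⊗ (1 : A) + j y ⊗ n -> counit n = 0 ->
    (forall h, j h * n = (Δ[h1, h2 <- h] (alpha h1 : k) *: (n * j h2))) ->
    \dim {:A} = (2 * \dim {:H})%N ->
    (forall a, exists h h' : H, a = j h + n * j h') ->
  bialg_iso (hopf_ops A) (biproduct_ops (Balphay alpha y)).
Proof.
move=> nn Dn en j_n dimA A_span.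
have [|phi phiE] := @linear_pack k (k^o * k^o)%type A (fun b => (b.1 : k)%:A + (b.2 : k) *: n).
  move=> c u v /=; rewrite !scalerDl !scalerDr !scalerA -!addrA; congr (_ + _).
  by rewrite addrCA.
pose e0 : (k^o * k^o)%type := (1, 0); pose e1 : (k^o * k^o)%type := (0, 1).
have phi0 : phi e0 = 1 by rewrite phiE scale1r scale0r addr0.
have phi1 : phi e1 = n by rewrite phiE scale1r scale0r add0r.
have phiM (b b' : (k^o * k^o)%type) :
    phi b * phi b' = phi (b.1 * b'.1, b.1 * b'.2 + b.2 * b'.1).
  rewrite !phiE /= mulrDl !mulrDr -!scalerAl -!scalerAr nn !scaler0 addr0 !mul1r mulr1.
  by rewrite !scalerA scalerDl addrA.
have j_phi h (b : (k^o * k^o)%type) : j h * phi b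
    = Δ[h1, h2 <- h] phi (counit h1 * b.1, alpha h1 * b.2) * j h2.
  transitivity ((b.1 : k) *: j h + (b.2 : k) *: (j h * n)).
    by rewrite phiE mulrDr -!scalerAr mulr1.
  rewrite j_n (tlift_map (g := fun x : A => (b.2 : k) *: x)); last by lin.
  rewrite -[in j h](sw_counitl (f := fun x => x) h); last by lin.
  rewrite (tlift_map (g := fun x => (b.1 : k) *: j x)); last by lin.
  rewrite -tlift_add; apply: eq_tlift => h1 h2; rewrite phiE /= mulrDl -!scalerAl mul1r.
  by rewrite linearZ !scalerA mulrC [X in _ + X *: _]mulrC.
pose f b h := phi b * j h.
have f1 h : linear (fun b => f b h) by rewrite /f; lin.
have f2 b : linear (fun h => f b h) by rewrite /f; lin.
apply: (bialg_iso_of_tens (f := f)) => //=.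
- by rewrite dimA [in RHS]dimvf.
- move=> a; have [h [h' ->]] := A_span a; exists (e0 ⊗ h + e1 ⊗ h').
  by rewrite tliftD !tliftE // /f phi0 phi1 mul1r.
- by rewrite tliftE // /f phi0 rmorph1 mulr1.
- move=> b h b' h'; rewrite (tlift_map (g := tlift f)); last by lin.
  have -> : f b h * f b' h' = phi b * (j h * phi b') * j h' by rewrite /f !mulrA.
  rewrite j_phi (tlift_map (g := fun a => phi b * a * j h')); last by lin.
  apply: eq_tlift => h1 h2; rewrite tliftE // /f rmorphM.
  by rewrite [phi b * (phi _ * _)]mulrA phiM /= !mulrA.
- move=> b h; have fE v z : tlift f (v ⊗ z) = f v z by rewrite tliftE.
  rewrite /tmap (tlift_map (g := tlift _)); last by lin.
  (* K v1 c v0 is the value of (v1 × c h_(1)) ⊗ (v0 × h_(2)) in A ⊗ A. *)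
  pose K v1 (c : H) (v0 : (k^o * k^o)%type) := Δ[h1, h2 <- h] f v1 (c * h1) ⊗ f v0 h2.
  have K1 c v : linear (fun w => K w c v) by rewrite /K; lin.
  have K2 v w : linear (fun c => K v c w) by rewrite /K; lin.
  have K3 v c : linear (K v c) by rewrite /K; lin.
  have KE v1 (v2 : (k^o * k^o)%type) :
      tlift (fun u w => tlift f u ⊗ tlift f w)
        (tlift (fun c v0 => Δ[h1, h2 <- h] (v1 ⊗ (c * h1 : H)) ⊗ (v0 ⊗ h2))
          ((v2.1 : k) *: ((1 : H) ⊗ e0) + (v2.2 : k) *: (y ⊗ e1)))
      = (v2.1 : k) *: K v1 1 e0 + (v2.2 : k) *: K v1 y e1.
    rewrite (tlift_map (g := tlift _)); last by lin.
    rewrite (eq_tlift (g := K v1)) => [|c v0]; last first.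
      rewrite (tlift_map (g := tlift _)); last by lin.
      by apply: eq_tlift => h1 h2; rewrite tliftE ?fE //; lin.
    by rewrite tlift_linear (linear_scale (tlift_linear _)) !tliftE.
  rewrite (eq_tlift (g := fun v1 (v2 : (k^o * k^o)%type) =>
    (v2.1 : k) *: K v1 1 e0 + (v2.2 : k) *: K v1 y e1)); last exact: KE.
  have lin_pair (V : vectType k) (X Y : V) :
      linear (fun v : (k^o * k^o)%type => (v.1 : k) *: X + (v.2 : k) *: Y).
    move=> c u v /=; rewrite !scalerDl scalerDr !scalerA -!addrA; congr (_ + _).
    by rewrite addrCA.
  rewrite tlift_linear (linear_scale (tlift_linear _)) tliftD.
  have KL v2 : linear (fun v1 => (v2.1 : k) *: K v1 1 e0 + (v2.2 : k) *: K v1 y e1).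
    by move=> c u v; rewrite !K1 !scalerDr !scalerA ![_ * c]mulrC addrACA.
  rewrite !tliftE //= !scale0r !scale1r !addr0 add0r.
  have K0 c w : K e0 c w = Δ[h1, h2 <- h] j (c * h1) ⊗ f w h2.
    by apply: eq_tlift => h1 h2; rewrite /f phi0 mul1r.
  have -> : K e0 1 e0 = comul (j h).
    rewrite K0 -[RHS]tlift_id sw_hopf; try by lin.
    by apply: eq_tlift => h1 h2; rewrite mul1r /f phi0 mul1r.
  have -> : K e1 1 e0 + K e0 y e1 = comul (n * j h).
    rewrite -[RHS]tlift_id sw_mul; try by lin.
    rewrite Dn tliftD !tliftE; try by lin.
    rewrite !sw_hopf; try by lin.
    rewrite K0; congr (_ + _); apply: eq_tlift => h1 h2.
      by rewrite /f phi0 phi1 !mul1r.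
    by rewrite /f phi1 rmorphM.
  by rewrite /f phiE mulrDl -!scalerAl mul1r linearD !linearZ.
- move=> b h; rewrite /f rmorphM /= j_hopf.2; congr (_ * _).
  by rewrite phiE linearD !linearZ /= rmorph1 en scaler0 addr0 [_ *: _]mulr1.
Qed.

End Isos.

(** * Structure of the two-dimensional coinvariants *)

Section RankTwo.
Variables (k : fieldType) (A H : hopfAlgType k).
Variables (p : {lrmorphism A -> H}) (j : {lrmorphism H -> A}).
Hypotheses (p_hopf : hopf_map p) (j_hopf : hopf_map j) (jK : cancel j p).
Variables (n : A) (nu : {linear A -> k^o}).
Hypotheses (cn : coinvariant p n) (en : counit n = 0) (nun : nu n = 1) (nu1 : nu 1 = 0).
Hypothesis projE : forall a, proj p j a = (counit a : k)%:A + (nu a : k) *: n.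
Implicit Types (V : vectType k) (a b : A) (h : H).

Lemma n_neq0 : n != 0.
Proof. by apply: contra_eq_neq nun => ->; rewrite raddf0 eq_sym oner_neq0. Qed.

Lemma nu_proj a : nu (proj p j a) = nu a.
Proof. by rewrite projE linearD !linearZ /= nu1 nun scaler0 add0r [_ *: _]mulr1. Qed.

Lemma nu_mulj a h : nu (a * j h) = (counit h : k) * nu a.
Proof. by rewrite -nu_proj proj_mulj // linearZ /= nu_proj. Qed.

Lemma nu_j h : nu (j h) = 0.
Proof. by rewrite -[j h]mul1r nu_mulj nu1 mulr0. Qed.

Lemma p_n : p n = 0.
Proof. by rewrite (coinv_p cn) en scale0r. Qed.

(** The decomposition [proj_mul_j], with proj expressed through nu. *)
Lemma nj_decomp a : a = j (p a) + n * j (Δ[x, y <- a] (nu x : k) *: p y).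
Proof.
rewrite -{1}(proj_mul_j j p_hopf a).
under eq_tlift do rewrite projE mulrDl -!scalerAl mul1r.
rewrite tlift_add; congr (_ + _).
  by rewrite (sw_counitl (f := fun y => j (p y))) //; lin.
rewrite (tlift_map (g := fun h => n * j h)); last by lin.
by apply: eq_tlift => x y; rewrite linearZ scalerAr.
Qed.

(** (id ⊗ nu) Delta: as nu(1) = 0 and nu(n) = 1, it reads the coefficient of n in
    the second factor of a coproduct.  Most of the constraints on n come from
    computing it in two ways. *)
Definition rcoef a : A := Δ[x, z <- a] (nu z : k) *: x.

Lemma rcoef_linear : linear rcoef.
Proof. by rewrite /rcoef; lin. Qed.

Lemma rcoef_grouplike a : grouplike a -> rcoef a = (nu a : k) *: a.
Proof. by move=> ga; rewrite /rcoef sw_grouplike //; lin. Qed.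

(** The grouplike u of Delta(n) = n ⊗ 1 + u ⊗ n. *)
Definition twist : A := rcoef n.

(** As n_(1) ⊗ n_(2) ⊗ p(n_(3)) = Delta(n) ⊗ 1, applying [proj_mul_j] to n_(2)
    gives Delta(n) = n_(1) ⊗ proj(n_(2)). *)
Lemma comul_n : comul n = n ⊗ (1 : A) + twist ⊗ n.
Proof.
have lp := proj_linear p j.
transitivity (Δ[x, y <- n] x ⊗ proj p j y).
  transitivity (Δ[x, y <- n] Δ[u, v <- y] x ⊗ (proj p j u * j (p v))).
    rewrite -{1}[comul n]tlift_id; apply: eq_tlift => x y.
    rewrite -{1}(proj_mul_j j p_hopf y) (tlift_map (g := ptens x)) //.
    exact: ptens_linearr.
  rewrite -sw_coassoc; try by lin.
  rewrite (coinv_sw (f := fun a h => Δ[x, y <- a] x ⊗ (proj p j y * j h)) cn); try by lin.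
  by apply: eq_tlift => x y; rewrite rmorph1 mulr1.
rewrite -[in X in _ = X + _](sw_counitr (f := fun x => x) n); last by lin.
rewrite (tlift_map (g := fun a : A => a ⊗ (1 : A))); last by lin.
rewrite /twist /rcoef [_ ⊗ n](tlift_map (g := fun a : A => a ⊗ n)); last by lin.
rewrite -tlift_add; apply: eq_tlift => x y; rewrite projE.
apply/matrixP=> a b; rewrite !mxE !linearD !linearZ /= mulrDr.
by congr (_ + _); rewrite mulrCA mulrA.
Qed.

Lemma sw_n V (f : A -> A -> V) :
    (forall b, linear (fun a => f a b)) -> (forall a, linear (fun b => f a b)) ->
  (Δ[a, b <- n] f a b) = f n 1 + f twist n.
Proof. by move=> f1 f2; rewrite comul_n tliftD !tliftE. Qed.

(** In Delta(n_(1)) ⊗ n_(2) = n_(1) ⊗ Delta(n_(2)) the coefficients of n in the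
    third factor are Delta(u) and u ⊗ u. *)
Lemma twist_grouplike : grouplike twist.
Proof.
split; last first.
  rewrite /twist /rcoef (tlift_map (g := counit)); last by lin.
  rewrite -nun -[in RHS](sw_counitl (f := nu) n); last by lin.
  by apply: eq_tlift => a b; rewrite linearZ [_ *: _]mulrC.
have <- : (Δ[a, b <- n] Δ[b, c <- b] (nu c : k) *: (a ⊗ b)) = twist ⊗ twist.
  rewrite sw_n; try by lin.
  rewrite sw_1; try by lin.
  rewrite sw_n; try by lin.
  by rewrite nu1 nun !scale0r scale1r !add0r.
rewrite -sw_coassoc; try by lin.
rewrite /twist /rcoef (tlift_map (g := comul)); last by lin.
apply: eq_tlift => a b; rewrite linearZ -{1}[comul a]tlift_id.
by apply: (tlift_map (g := fun t : tens A A => _ *: t)); lin.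
Qed.

(** The candidate for the grouplike y of case (a). *)
Definition yH : H := p twist.

Lemma yH_grouplike : grouplike yH.
Proof. exact: grouplike_hopf p_hopf twist_grouplike. Qed.

Lemma twistE : twist = (1 + (nu twist : k) *: n) * j yH.
Proof.
have lp := proj_linear p j.
rewrite -{1}(proj_mul_j j p_hopf twist).
rewrite (sw_grouplike (f := fun a b => proj p j a * j (p b)) twist_grouplike); try by lin.
by rewrite projE twist_grouplike.2 scale1r.
Qed.

(** The character through which H acts on the line of n: proj(j(h) n) is
    act_char(h) n. *)
Definition act_char h : k^o := nu (j h * n).

Lemma act_char_linear : linear act_char.
Proof. by rewrite /act_char; lin. Qed.

Lemma j_n h : j h * n = (Δ[h1, h2 <- h] (act_char h1 : k) *: (n * j h2)).
Proof.
rewrite (mulj_coinv p_hopf j_hopf jK h cn); apply: eq_tlift => a b.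
by rewrite projE rmorphM /= en mulr0 scale0r add0r -scalerAl.
Qed.

Lemma act_char1 : act_char 1 = 1.
Proof. by rewrite /act_char rmorph1 mul1r. Qed.

(** Move h past n first; then nu(j(g) n j(h_(2))) is act_char(g) times the counit
    of h_(2). *)
Lemma act_charM g h : act_char (g * h) = act_char g * act_char h.
Proof.
have la := act_char_linear.
rewrite {1}/act_char rmorphM -mulrA j_n.
rewrite (tlift_map (g := fun a => nu (j g * a))); last by lin.
rewrite -[in RHS](sw_counitr (f := act_char) h) //.
rewrite (tlift_map (g := fun x : k^o => act_char g * x)); last by lin.
apply: eq_tlift => a b; rewrite -scalerAr linearZ mulrA nu_mulj -/(act_char g).
transitivity (act_char a * ((counit b : k) * act_char g) : k); first by [].
by rewrite mulrC -mulrA mulrCA.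
Qed.

(** Both sides are (p ⊗ nu) Delta(j(h) n): expanding the coproduct of the product
    directly gives the left one, moving h past n first gives the right one. *)
Lemma act_char_compat h : lharp act_char h * yH = yH * rharp h act_char.
Proof.
have la := act_char_linear.
rewrite /lharp (tlift_map (g := fun x => x * yH)); last by lin.
rewrite /rharp (tlift_map (g := fun x => yH * x)); last by lin.
transitivity (Δ[h1, h2 <- h] (act_char h2 : k) *: (h1 * yH)).
  by apply: eq_tlift => a b; rewrite -scalerAl.
transitivity (Δ[h1, h2 <- h] (act_char h1 : k) *: (yH * h2)); last first.
  by apply: eq_tlift => a b; rewrite -scalerAr.
transitivity (Δ[a, b <- j h * n] (nu b : k) *: p a).
  rewrite sw_mul; try by lin.
  rewrite sw_hopf; try by lin.
  apply: eq_tlift => a b; rewrite sw_n; try by lin.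
  by rewrite mulr1 nu_j scale0r add0r rmorphM /= jK.
have lT : linear (fun a : A => Δ[x, z <- a] (nu z : k) *: p x) by lin.
rewrite {1}j_n (tlift_map lT); apply: eq_tlift => a b.
rewrite (linear_scale lT); congr (_ *: _).
rewrite sw_mul; try by lin.
rewrite sw_n; try by lin.
rewrite !sw_hopf; try by lin.
rewrite -[RHS]add0r -[in RHS](sw_counitr (f := fun x => yH * x) b); last by lin.
congr (_ + _); first last.
  by apply: eq_tlift => c d; rewrite nu_mulj nun mulr1 rmorphM /= jK.
rewrite (eq_tlift (g := fun _ _ => 0)) => [|c d].
  by rewrite /tlift big1 // => r _; rewrite big1 // => s _; rewrite scaler0.
by rewrite rmorphM /= p_n mul0r scaler0.
Qed.

Definition sq_coef : k := nu (n * n).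

Lemma n_sq : n * n = sq_coef *: n.
Proof.
have := proj_coinvariant j_hopf jK (coinvariantM cn cn).
by rewrite projE rmorphM /= en mulr0 scale0r add0r => <-.
Qed.

Lemma rcoef_nM a : rcoef (n * a) = (Δ[x, z <- a] (nu z : k) *: (n * x))
    + (Δ[x, z <- a] (nu (n * z) : k) *: (twist * x)).
Proof.
rewrite /rcoef sw_mul; try by lin.
rewrite sw_n; try by lin.
by congr (_ + _); apply: eq_tlift => x z; rewrite mul1r.
Qed.

Lemma jyH_n : j yH * n = (act_char yH : k) *: (n * j yH).
Proof.
have la := act_char_linear.
by rewrite j_n (sw_grouplike yH_grouplike) //; lin.
Qed.

Lemma jyH_grouplike : grouplike (j yH).
Proof. exact: grouplike_hopf j_hopf yH_grouplike. Qed.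

Section NotChar2.
Hypothesis char_k : 2%N \notin [pchar k].

Lemma two_neq0 : (1 + 1 : k) != 0.
Proof. by move: char_k; rewrite inE /= -mulr2n. Qed.

(** With Y = j(y), the two values of [rcoef] at n^2 are n Y + Y n + s Y^2 and s Y,
    for n^2 = s n.  Applying nu gives 1 + alpha(y) = 0; applying p gives
    s y^2 = s y.  If s were not 0, then y would be 1, so that alpha(y) = 1,
    whereas alpha(y) = -1 and 2 is invertible. *)
Lemma skew_primitive_case : nu twist = 0 ->
  [/\ twist = j yH, n * n = 0 & act_char yH = -1].
Proof.
move=> c0; have uY : twist = j yH by rewrite twistE c0 scale0r addr0 mul1r.
have E : n * j yH + (act_char yH : k) *: (n * j yH) + sq_coef *: (j yH * j yH)
    = sq_coef *: j yH.
  have <- : rcoef (n * n) = sq_coef *: j yH.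
    by rewrite n_sq (linear_scale rcoef_linear) -/twist uY.
  rewrite rcoef_nM.
  rewrite !sw_n; try by lin.
  by rewrite !mulr1 nu1 nun scale0r add0r !scale1r uY jyH_n addrA.
have ay : act_char yH = -1.
  apply/eqP; rewrite -addr_eq0 addrC.
  have := congr1 nu E; rewrite !linearD !linearZ /= -rmorphM !nu_j !nu_mulj nun.
  by rewrite yH_grouplike.2 !mulr1 !scaler0 addr0 [_ *: _]mulr1 => ->.
split=> //; rewrite n_sq; have [->|sq0] := eqVneq sq_coef 0; first by rewrite scale0r.
have := congr1 p E; rewrite !linearD !linearZ /= !rmorphM /= !jK p_n mul0r scaler0 !add0r.
move=> /(scalerI sq0) yy; have y1 : yH = 1.
  by apply: (mulrI (grouplike_unit yH_grouplike)); rewrite yy mulr1.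
move/eqP: ay; rewrite y1 act_char1 -addr_eq0; have := two_neq0.
by move=> /negPf->.
Qed.

(** With c = nu(u), the two values of [rcoef] at u = (1 + c n) j(y) are c u and
    c u j(y), and u is invertible; hence y = 1.  Then u^2 = 1 + d n, and [rcoef]
    at the grouplike u^2 is both d u^2 and d u, which forces d = 0 because u is
    not 1.  If n^2 were 0, d would be 2c. *)
Lemma grouplike_case : nu twist != 0 ->
  [/\ yH = 1, twist = 1 + (nu twist : k) *: n, twist * twist = 1 & sq_coef != 0].
Proof.
move=> c0; have su := grouplike_unit twist_grouplike.
have y1 : yH = 1.
  suff uY : twist * j yH = twist * 1.
    by rewrite -[yH]jK (mulrI su uY) rmorph1.
  apply: (@scalerI k A (nu twist) c0); rewrite mulr1 -(rcoef_grouplike twist_grouplike).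
  rewrite {3}twistE mulrDl mul1r -scalerAl.
  have [R RE] := linear_pack rcoef_linear; rewrite -RE linearD linearZ /= !RE.
  rewrite rcoef_grouplike ?nu_j ?scale0r ?add0r; last exact: jyH_grouplike.
  rewrite rcoef_nM !(sw_grouplike jyH_grouplike); try by lin.
  by rewrite nu_j nu_mulj nun yH_grouplike.2 mulr1 scale0r scale1r add0r.
have uE : twist = 1 + (nu twist : k) *: n by rewrite {1}twistE y1 rmorph1 mulr1.
pose c : k := nu twist; pose d := c + c + c * c * sq_coef.
have uu : twist * twist = 1 + d *: n.
  rewrite uE -/c mulrDl !mulrDr !mul1r !mulr1 -scalerAl -scalerAr n_sq !scalerA.
  by rewrite /d -!addrA !scalerDl.
have d0 : d = 0.
  apply/eqP/negPn/negP=> d0.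
  have guu := grouplikeM twist_grouplike twist_grouplike.
  have nuuu : nu (twist * twist) = d.
    by rewrite uu linearD linearZ /= nu1 nun add0r [_ *: _]mulr1.
  have := rcoef_grouplike guu; rewrite nuuu {1}uu.
  have [R RE] := linear_pack rcoef_linear; rewrite -RE linearD linearZ /= !RE.
  have -> : rcoef 1 = 0 by rewrite /rcoef sw_1 ?nu1 ?scale0r //; lin.
  rewrite add0r -/twist => /(@scalerI k A d d0).
  rewrite -{1}[twist]mulr1 => /(mulrI su) /eqP; rewrite uE -{1}[1]addr0.
  rewrite (inj_eq (addrI _)) eq_sym scaler_eq0 (negPf n_neq0) orbF.
  by rewrite (negPf c0).
split=> //; first by rewrite uu d0 scale0r addr0.
apply: contraNneq c0 => sq0; move/eqP: d0; rewrite /d sq0 mulr0 addr0.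
by rewrite -[c]mulr1 -mulrDr mulf_eq0 (negPf two_neq0) orbF.
Qed.

(** From n^2 = s n, moving h past both factors of n^2 gives
    s alpha(h) = s alpha(h_(1)) alpha(h_(2)): alpha is idempotent for convolution,
    and it is invertible with inverse alpha S. *)
Lemma act_char_trivial h : sq_coef != 0 -> act_char h = counit h.
Proof.
move=> sq0; have la := act_char_linear.
have idem g : (Δ[a, b <- g] act_char a * act_char b : k^o) = act_char g.
  apply: (mulfI sq0).
  transitivity (nu (j g * n * n)); last by rewrite -mulrA n_sq -scalerAr linearZ.
  rewrite j_n (tlift_map (g := fun a => nu (a * n))); last by lin.
  rewrite (tlift_map (g := fun x : k^o => sq_coef * x : k^o)); last by lin.
  apply: (@eq_tlift k H H k^o) => a b; rewrite -scalerAl linearZ /= -mulrA j_n.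
  rewrite (tlift_map (g := fun a => nu (n * a))); last by lin.
  rewrite mulrCA -[in LHS](sw_counitr (f := act_char) b) //; congr (_ * _).
  rewrite (tlift_map (g := fun x : k^o => sq_coef * x : k^o)); last by lin.
  apply: (@eq_tlift k H H k^o) => c d; rewrite -scalerAr linearZ /= [n * (n * _)]mulrA nu_mulj.
  change (sq_coef * ((counit d : k) * act_char c) = act_char c * ((counit d : k) * sq_coef)).
  by rewrite mulrCA [sq_coef * _]mulrC mulrCA.
have inv g : (Δ[a, b <- g] act_char (antipode a) * act_char b : k^o) = counit g.
  rewrite -[RHS]mulr1 -act_char1 -[RHS](sw_antipodel (f := act_char)) //.
  by apply: eq_tlift => a b; rewrite act_charM.
rewrite -(inv h) -[LHS](sw_counitl (f := act_char)) //.
transitivity (Δ[a, c <- h] Δ[a, b <- a] (act_char (antipode a) * act_char b * act_char c : k^o)).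
  apply: (@eq_tlift k H H k^o) => a b; rewrite -(inv a).
  rewrite [LHS](tlift_map (g := fun x : k^o => x * act_char b : k^o)) //.
  by move=> c u v; rewrite mulrDl scalerAl.
rewrite sw_coassoc; try by lin.
apply: (@eq_tlift k H H k^o) => a b; rewrite -(idem b).
rewrite [in RHS](tlift_map (g := fun x : k^o => act_char (antipode a) * x : k^o)); last by lin.
by apply: eq_tlift => c d; rewrite mulrA.
Qed.

Lemma j_n_comm h : sq_coef != 0 -> j h * n = n * j h.
Proof.
move=> sq0; rewrite j_n -[in RHS](sw_counitl (f := fun x => n * j x) h); last by lin.
by apply: eq_tlift => a b; rewrite act_char_trivial.
Qed.

(** A is spanned by the elements j(h) and n j(h), and j(h) n lies in n j(H). *)
Lemma nilpotent_ideal a : n * n = 0 -> n * a * n = 0.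
Proof.
move=> nn; rewrite (nj_decomp a) mulrDr mulrDl mulrA nn !mul0r addr0 -mulrA j_n.
rewrite (tlift_map (g := fun x => n * x)); last by lin.
rewrite /tlift big1 // => r _; rewrite big1 // => s _.
by rewrite -scalerAr mulrA nn mul0r !scaler0.
Qed.

End NotChar2.

End RankTwo.

(** * The classification *)

Theorem corollary2 (k : fieldType) (A H : hopfAlgType k)
    (i : {lrmorphism H -> A})
    (char_k : 2%N \notin [pchar k])
    (i_hopf : hopf_map i) (i_inj : injective i)
    (A_proj : hopf_projection A H)
    (A_free : free_right_module i 2) :
  let case_a :=
    exists (alpha : {lrmorphism H -> k^o}) (alpha_inv : {linear H -> k^o}) (y : H),
      [/\ convolution_inverse alpha alpha_inv,
          grouplike y,
          alpha y = -1,
          forall h : H, rharp (lharp alpha h) alpha_inv = y * h * y^-1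
        & bialg_iso (hopf_ops A) (biproduct_ops (Balphay alpha y))] in
  let case_b :=
    bialg_iso (hopf_ops A)
      (tensor_ops (group_algebra_ops k 'Z_2) (hopf_ops H)) in
  (case_a \/ case_b) /\ (semisimple_alg A -> case_b).
Proof.
move=> case_a case_b.
have dimA := free_right_module_dim A_free.
have [p [j [p_hopf j_hopf jK]]] := A_proj.
have [n [nu [cn en nun nu1 projE]]] := coinvariant_dim2 p_hopf j_hopf jK dimA.
have A_span a : exists h h' : H, a = j h + n * j h'.
  by do 2!eexists; exact: (nj_decomp p_hopf projE).
pose g := twist n nu.
suff : (case_a /\ forall a, n * a * n = 0) \/ case_b.
  case=> [[caseA nAn]|caseB]; last by split=> [|_] //; right.
  split=> [|ssA]; first by left.
  by have := n_neq0 nun; rewrite (semisimple_semiprime ssA nAn) eqxx.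
(* g = (1 + c n) j(y) with c = nu(g): the dichotomy is whether c vanishes. *)
have [c0|c0] := eqVneq (nu g) 0; [left|right].
- have [gE nn ay] := skew_primitive_case p_hopf j_hopf jK cn en nun nu1 projE char_k c0.
  split=> [|a]; last exact: (nilpotent_ideal p_hopf j_hopf jK cn en projE).
  pose y' := yH p n nu.
  pose al : {lrmorphism H -> k^o} := HB.pack_for {lrmorphism H -> k^o} (act_char j n nu)
    (GRing.isLinear.Build k H k^o _ (act_char j n nu) (act_char_linear j n nu))
    (GRing.isMonoidMorphism.Build H k^o (act_char j n nu)
      (act_char1 j nun, act_charM p_hopf j_hopf jK cn en nun nu1 projE)).
  have [|al_inv al_invE] := @linear_pack k H k^o (fun h => al (antipode h)); first by lin.
  have inv_al : convolution_inverse al al_inv.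
    move=> h; have [E1 E2] := convolution_inverse_antipode al h.
    by split; [rewrite -E1 | rewrite -E2]; apply: (@eq_tlift k H H k^o) => a b; rewrite al_invE.
  have gy : grouplike y' := yH_grouplike p_hopf cn nun nu1 projE.
  exists al, al_inv, y'; split=> //.
    move=> h; apply: harpoon_conj => //; first exact: grouplike_unit.
    move=> x; exact: (act_char_compat p_hopf j_hopf jK cn en nun nu1 projE x).
  apply: (biproduct_iso (n := n) j_hopf) => //.
  - by rewrite (comul_n p_hopf cn projE) gE.
  - exact: (j_n p_hopf j_hopf jK cn en projE).
have [y1 gE gg sq0] := grouplike_case p_hopf j_hopf jK cn en nun nu1 projE char_k c0.
have j_comm := j_n_comm p_hopf j_hopf jK cn en nun nu1 projE.
have gg' : grouplike g := twist_grouplike p_hopf cn nun nu1 projE.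
apply: (group_algebra_tensor_iso (gr := fun x : 'Z_2 => g ^+ x) j_hopf).
- by [].
- by case=> [[|[|//]] ?] [[|[|//]] ?] /=; rewrite ?expr0 ?mulr1 ?mul1r // expr1 gg.
- by case=> [[|[|//]] ?] /=; rewrite ?expr0 //; exact: grouplike1.
- case=> [[|[|//]] ?] h /=; rewrite ?expr0 ?mul1r ?mulr1 // expr1 /g gE.
  by rewrite mulrDr mulrDl mul1r mulr1 -scalerAl -scalerAr j_comm.
- by rewrite card_ord.
- move=> a; have [h [h' ->]] := A_span a.
  (* In terms of g = 1 + c n, the element n is c^-1 (g - 1). *)
  exists (fun x : 'Z_2 => if x == 0 then h - ((nu g)^-1 : k) *: h' else ((nu g)^-1 : k) *: h').
  rewrite big_ord_recl big_ord1 /= expr0 expr1 mul1r {2}/g gE linearB !linearZ /= mulrDl mul1r.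
  by rewrite scalerN addrA subrK -scalerAr -scalerAl scalerA mulVf // scale1r.
Qed.
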